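(* Let $H$ be a complex Hilbert space and let $T\in B(H)$ be a partial isometry that is rank one and non-normal. (i) If $T$ is a power partial isometry, then $\mathcal S(T,T^* )$ is simple. (ii) If $\operatorname{tr}T\in\mathbb R$, then $\mathcal S(T,T^* )$ is an SI semigroup. But in this case $\mathcal S(T,T^* )$ can be nonsimple: there exist a complex Hilbert space $H$ and a non-normal rank one partial isometry $T\in B(H)$ with $\operatorname{tr}T\in\mathbb R$ for which $\mathcal S(T,T^* )$ is not simple.
   Context: $H$ may be finite or infinite dimensional; $B(H)$ is the set of bounded linear operators on $H$. $T$ is a power partial isometry if $T^n$ is a partial isometry for every $n\ge1$. $\mathcal S(T,T^* )$ is the semigroup generated by $\{T,T^*\}$, i.e. the set of all finite nonempty words in $T$ and $T^*$. An ideal $J$ of a multiplicative semigroup $\mathcal S\subset B(H)$ is a (two-sided) multiplicative ideal: a subset $J\subset\mathcal S$ with $XA, AX\in J$ for all $A\in J$, $X\in\mathcal S$ (no closure under sums or scalars is required). $\mathcal S$ is a selfadjoint-ideal (SI) semigroup if every ideal $J$ of $\mathcal S$ satisfies $\{A^*: A\in J\}\subset J$. $\mathcal S$ is simple if its only nonzero ideal (i.e. ideal containing a nonzero operator) is $\mathcal S$ itself; $\mathcal S$ may or may not contain $0$. $\operatorname{tr}$ denotes the trace. *)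

(* Defs.v *)
From HB Require Import structures.
From mathcomp Require Import all_boot all_order all_algebra finmap.
From mathcomp Require Import complex.
From mathcomp Require Import boolp classical_sets functions reals.
From mathcomp Require Import topology normedtype.
From mathcomp.analysis Require Import showcase.summability.
Set Implicit Arguments.
Unset Strict Implicit.
Unset Printing Implicit Defensive.
Import Order.TTheory GRing.Theory Num.Theory Num.Def.
Import numFieldNormedType.Exports.
Local Open Scope classical_set_scope.
Local Open Scope complex_scope.
Local Open Scope ring_scope.

(* [dotp] is linear in its first argument and conjugate-linear in its second;
   completeness is that of the underlying normed module, whose norm takes its
   values in the nonnegative reals of [R[i]]. *)
HB.mixin Record NormedModule_isHilbert (R : realType) H
    & CompleteNormedModule R[i] H := {
  dotp : {dot H for (@conjC R[i])} ;
  dotp_normE : forall x : H, dotp x x = `|x| ^+ 2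
}.

#[short(type="hilbertType")]
HB.structure Definition Hilbert (R : realType) :=
  {H of CompleteNormedModule R[i] H & NormedModule_isHilbert R H}.

Local Notation "''[' x , y ]" := (dotp x y) : ring_scope.

(* The library declares this instance inside a section, hence locally. *)
#[global] Existing Instance totally_filter.

Section Operators.
Variables (R : realType) (H : hilbertType R).
Implicit Types (S T A X : H -> H) (G J : set (H -> H)) (B : set H).

Definition bounded_operator T :=
  linear T /\ exists M : R[i], forall x, `|T x| <= M * `|x|.

Definition is_adjoint T S := forall x y, '[T x, y] = '[x, S y].

(* For bounded [T] the adjoint exists (Riesz) and is unique, so the default
   value of [xget] is irrelevant. *)
Definition adjoint T : H -> H := xget (fun=> 0) [set S | is_adjoint T S].

Definition normal_operator T := adjoint T \o T = T \o adjoint T.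

Definition in_ker_orthogonal T (x : H) := forall z, T z = 0 -> '[x, z] = 0.

Definition partial_isometry T :=
  forall x, in_ker_orthogonal T x -> `|T x| = `|x|.

Definition power_partial_isometry T :=
  forall n, (1 <= n)%N -> partial_isometry (iter n T).

Definition rank_one T :=
  exists2 u : H, u != 0 & range T = [set c *: u | c in [set: R[i]]].

Definition orthonormal_basis B :=
  [/\ forall e, B e -> '[e, e] = 1,
      forall e f, B e -> B f -> e <> f -> '[e, f] = 0 &
      forall x, (forall e, B e -> '[x, e] = 0) -> x = 0].

(* Unconditional convergence (along the directed set of finite subsets) of the
   sum of the <T e, e> over any orthonormal basis, to the same value [t]. *)
Definition has_trace T (t : R[i]) :=
  forall B, orthonormal_basis B ->
    partial_sum (fun e : B => '[T (val e), val e]) @ totally --> (t : R[i]^o).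

(* The default value of [xget] is only reached when [T] has no trace, which
   does not happen for finite rank operators. *)
Definition trace T : R[i] := xget 0 [set t | has_trace T t].

Inductive generated_semigroup G : set (H -> H) :=
| generated_mem A : G A -> generated_semigroup G A
| generated_mul A X : generated_semigroup G A -> generated_semigroup G X ->
    generated_semigroup G (A \o X).

Definition semigroup_adj T := generated_semigroup [set T; adjoint T].

Definition semigroup_ideal (SG J : set (H -> H)) :=
  J `<=` SG /\ forall A X, J A -> SG X -> J (X \o A) /\ J (A \o X).

Definition SI_semigroup (SG : set (H -> H)) :=
  forall J, semigroup_ideal SG J -> adjoint @` J `<=` J.

Definition simple_semigroup (SG : set (H -> H)) :=
  forall J, semigroup_ideal SG J -> (exists2 A, J A & A <> (fun=> 0)) -> J = SG.

End Operators.

(* Main.v *)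
(* In an orthonormal basis, coefficients with bounded sums of squares define a
   convergent sum; this yields Parseval's identity and Riesz representation, so
   T = <., v> u with unit vectors u, v, and the trace of T is t = <u, v>. Every
   word in T, T^* is c <., q> p with p, q in {u, v}, c a product of powers of t
   and its conjugate, and <., q> p itself is always a word. If T^2 = t T is a
   partial isometry then |t| is 0 or 1; |t| = 1 forces T normal, and for t = 0
   all c are 0 or 1, whence simplicity. If t is real, A = c <., q> p satisfies
   A^* = X A X with X = <., p> q. If 0 < |t| < 1, the words of norm at most |t|
   form a proper nonzero ideal; unit vectors in C^2 with t = 3/5 are an
   instance. *)
Require Import Defs.
From HB Require Import structures.
From mathcomp Require Import all_boot all_order all_algebra finmap.
From mathcomp Require Import complex boolp classical_sets functions reals.
From mathcomp Require Import topology normedtype ring.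
From mathcomp.analysis Require Import showcase.summability.
Set Implicit Arguments.
Unset Strict Implicit.
Unset Printing Implicit Defensive.
Import Order.TTheory GRing.Theory Num.Theory.
Import numFieldNormedType.Exports.
Local Open Scope classical_set_scope.
Local Open Scope complex_scope.
Local Open Scope ring_scope.

Local Notation "''[' x , y ]" := (dotp x y) : ring_scope.

(** * Inner products: Cauchy-Schwarz and continuity *)

Section InnerProduct.
Variables (R : realType) (H : hilbertType R).
Implicit Types (x y z u v w : H) (c : R[i]).

Lemma dotpC x y : '[x, y] = '[y, x]^*.
Proof. by rewrite hermC expr0 mul1r. Qed.

Lemma dotpZl c x y : '[c *: x, y] = c * '[x, y].
Proof. exact: linearZl_LR. Qed.

Lemma dotpZr c x y : '[x, c *: y] = c^* * '[x, y].
Proof. exact: linearZr_LR. Qed.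

Lemma dotp0_eq0 x : (forall y, '[x, y] = 0) -> x = 0.
Proof. by move=> /(_ x)/eqP; rewrite dnorm_eq0 => /eqP. Qed.

Lemma dotp_unit x : `|x| = 1 -> '[x, x] = 1.
Proof. by move=> x1; rewrite dotp_normE x1 expr1n. Qed.

Lemma pythagoras x y : '[x, y] = 0 -> `|x + y| ^+ 2 = `|x| ^+ 2 + `|y| ^+ 2.
Proof. by move=> xy; rewrite -!dotp_normE; exact: hnormDd. Qed.

(** Split [x] into a multiple of [y] and a remainder [z] orthogonal to [y]. By Pythagoras the two
    squared sides differ by [|z|^2 |y|^2]. *)
Lemma CauchySchwarz_dotp x y : `|'[x, y]| <= `|x| * `|y|.
Proof.
have [->|y0] := eqVneq y 0; first by rewrite linear0r !normr0 mulr0.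
have ny0 : `|y| ^+ 2 != 0 by rewrite expf_neq0 ?normr_eq0.
rewrite -(@ler_pXn2r _ 2) ?nnegrE ?mulr_ge0 // exprMn.
pose a := '[x, y] / `|y| ^+ 2.
have oy : '[x - a *: y, y] = 0.
  by rewrite linearBl /= dotpZl dotp_normE divfK ?subrr.
have -> : x = (x - a *: y) + a *: y by rewrite subrK.
set z := x - a *: y in oy *.
rewrite linearDl /= oy add0r dotpZl dotp_normE.
rewrite pythagoras; last by rewrite dotpZr oy mulr0.
rewrite mulrDl normrM exprMn normrZ exprMn.
have -> : `|(`|y| ^+ 2)| = `|y| ^+ 2 by rewrite ger0_norm // exprn_ge0.
by rewrite (expr2 (`|y| ^+ 2)) mulrA lerDr mulr_ge0 // exprn_ge0.
Qed.

Lemma cvg_dotpl (I : Type) (F : set_system I) (FF : Filter F) (f : I -> H) x y :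
  f @ F --> x -> (fun i => '[f i, y]) @ F --> ('[x, y] : R[i]^o).
Proof.
move=> fx; apply/cvgrPdist_lt => e e0.
(* Adding 1 keeps the divisor positive when [y = 0]. *)
have y1 : 0 < `|y| + 1 by rewrite ltr_wpDl.
have d0 : 0 < e / (`|y| + 1) by rewrite divr_gt0.
move/cvgrPdist_lt: fx => /(_ _ d0); apply: filterS => i.
rewrite -linearBl /= => fi.
apply: le_lt_trans (CauchySchwarz_dotp _ _) _.
apply: (@le_lt_trans _ _ (`|x - f i| * (`|y| + 1))).
  by rewrite ler_wpM2l // lerDl.
by rewrite -ltr_pdivlMr.
Qed.

End InnerProduct.

Lemma cvg_complex_unique (R : realType) (I : Type) (F : set_system I)
    {FF : ProperFilter F} (f : I -> R[i]^o) (x y : R[i]^o) :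
  f @ F --> x -> f @ F --> y -> x = y.
Proof. exact: norm_cvg_unique. Qed.

Lemma partial_sumE (I : choiceType) (V : zmodType) (f : I -> V) (A : {fset I}) :
  partial_sum f A = \sum_(i <- A) f i.
Proof. by rewrite /partial_sum (big_seq_fsetE _ _ predT f). Qed.

(** * Orthonormal systems: bases, Bessel, Parseval, Riesz *)

Section OrthonormalSystems.
Variables (R : realType) (H : hilbertType R).
Implicit Types (x y z u v w : H) (B : set H).

Definition orthonormal_system B :=
  (forall e, B e -> '[e, e] = 1) /\
  (forall e f, B e -> B f -> e <> f -> '[e, f] = 0).

(** Zorn: any two vectors in the union of a chain of orthonormal systems lie in a common member, so
    the union is orthonormal. A nonzero vector orthogonal to a maximal system could be normalised
    and added to it. *)
Lemma orthonormal_basis_exists : exists B : set H, orthonormal_basis B.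
Proof.
have [F FP Ftot|B [[B1 B0] maxB]] := @Zorn_bigcup H orthonormal_system.
  split=> [e [X FX Xe]|e f [X FX Xe] [Y FY Yf] ef].
    by have [X1 _] := FP _ FX; exact: X1.
  have [XY|YX] := Ftot _ _ FX FY.
    by have [_] := FP _ FY; apply => //; exact: XY.
  by have [_] := FP _ FX; apply => //; exact: YX.
exists B; split=> // x xB; apply/eqP/negPn/negP => x0.
have nx0 : `|x| != 0 by rewrite normr_eq0.
pose e := `|x|^-1 *: x.
have e1 : '[e, e] = 1.
  by apply: dotp_unit; rewrite normrZ normfV normr_id mulVf.
have eB f : B f -> '[e, f] = 0 by move=> Bf; rewrite dotpZl xB ?mulr0.
apply: (maxB (e |` B)).
  rewrite properEneq; split; last by move=> f; right.
  apply/eqP => BE; have /eB : B e by rewrite BE; left.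
  by rewrite e1; apply/eqP; rewrite oner_eq0.
split=> [f [->//|/B1//]|f g [->|Bf] [->|Bg] fg //]; last exact: B0.
- exact: eB.
- by rewrite dotpC eB // conjC0.
Qed.

(** * Unconditional sums over an orthonormal system *)

Section Sums.
Variables (B : set H) (Bon : orthonormal_system B).
Implicit Types (a b : B -> R[i]) (A : {fset B}).

Definition osum a : {fset B} -> H := partial_sum (fun e : B => a e *: val e).

Lemma osumE a A : osum a A = \sum_(e <- A) a e *: val e.
Proof. exact: partial_sumE. Qed.

Lemma dotp_osuml a A y : '[osum a A, y] = \sum_(e <- A) a e * '[val e, y].
Proof. by rewrite osumE linear_sumlz /=; apply: eq_bigr => e _; rewrite dotpZl. Qed.

Lemma dotp_val (e f : B) : '[val e, val f] = (e == f)%:R.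
Proof.
case: Bon => B1 B0; have [->|ef] := eqVneq e f.
  by rewrite B1 //; exact: set_valP.
rewrite B0 //; [exact: set_valP|exact: set_valP|].
by move=> /val_inj /eqP; rewrite (negPf ef).
Qed.

Lemma dotp_osum_val a A (f : B) : f \in A -> '[osum a A, val f] = a f.
Proof.
move=> fA; rewrite dotp_osuml (big_fsetD1 f) //= dotp_val eqxx mulr1.
rewrite big_seq big1 ?addr0 // => e; rewrite !inE => /andP[/negPf ef _].
by rewrite dotp_val ef mulr0.
Qed.

Lemma norm_osum a A : `|osum a A| ^+ 2 = \sum_(e <- A) `|a e| ^+ 2.
Proof.
rewrite -dotp_normE dotp_osuml big_seq [RHS]big_seq.
by apply: eq_bigr => e eA; rewrite dotpC dotp_osum_val // normCK.
Qed.

Lemma osum_fsetD a A A' : (A `<=` A')%fset ->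
  osum a A' = osum a A + osum a (A' `\` A)%fset.
Proof.
move=> AA'; rewrite !osumE (big_fsetID _ (mem A)) /=; congr (_ + _).
  by apply: eq_fbigl => e; rewrite !inE andbC; apply/andb_idr/(fsubsetP AA').
by apply: eq_fbigl => e; rewrite !inE andbC.
Qed.

Lemma norm_osum_fsetD a A A' : (A `<=` A')%fset ->
  `|osum a A'| ^+ 2 = `|osum a A| ^+ 2 + `|osum a (A' `\` A)%fset| ^+ 2.
Proof.
move=> AA'; rewrite !norm_osum (big_fsetID _ (mem A)) /=; congr (_ + _).
  by apply: eq_fbigl => e; rewrite !inE andbC; apply/andb_idr/(fsubsetP AA').
by apply: eq_fbigl => e; rewrite !inE andbC.
Qed.

(** The squared norms grow with [A] and are bounded, so they have a supremum. Once [A] nearly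
    attains it, Pythagoras makes every further contribution small, hence the net is Cauchy. *)
Lemma cvg_osum a (M : R[i]) : (forall A, `|osum a A| ^+ 2 <= M) ->
  exists2 w : H, osum a @ totally --> w & forall e : B, '[w, val e] = a e.
Proof.
(* Real parts are taken because the supremum is formed in [R]. *)
move=> bM; pose q A := complex.Re (`|osum a A| ^+ 2).
have qsup : has_sup (range q).
  split; first by exists (q fset0), fset0.
  exists (complex.Re M); apply/ubP => _ [A _ <-].
  by have := bM A; rewrite lecE => /andP[].
have cau : cauchy (osum a @ totally).
  apply: cauchy_exP => e e0.
  have eE : e = (complex.Re e)%:C by rewrite RRe_real ?gtr0_real.
  have r0 : 0 < complex.Re e by rewrite -ltcR -eE.
  (* [A] comes within [r^2] of the supremum, so enlarging it moves the sum by less than [r]. *)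
  have [_ [A _ <-] qA] := sup_adherent (exprn_gt0 2 r0) qsup.
  exists (osum a A); exists A => // A' /= AA'.
  rewrite -ball_normE /= (osum_fsetD _ AA') opprD addNKr normrN.
  rewrite -(@ltr_pXn2r _ 2) ?nnegrE ?(ltW e0) //.
  have qA' : q A' <= sup (range q) by apply: sup_upper_bound => //; exists A'.
  move: qA'; rewrite /q (norm_osum_fsetD _ AA').
  set d := osum _ (_ `\` _)%fset; rewrite raddfD /= => qA'.
  have -> : `|d| ^+ 2 = (complex.Re (`|d| ^+ 2))%:C.
    by rewrite RRe_real ?ger0_real ?exprn_ge0.
  rewrite eE -rmorphXn ltcR -(ltrD2l (complex.Re (`|osum a A| ^+ 2))).
  by apply: le_lt_trans qA' _; rewrite -ltrBlDr.
have /cvg_ex[/= w cw] : cvg (osum a @ totally) by exact: cauchy_cvg.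
exists w => // e.
apply: (@cvg_complex_unique _ _ totally _ (fun A => '[osum a A, val e])).
  exact: cvg_dotpl cw.
(* The coefficient at [e] is constant as soon as [e] belongs to [A]. *)
apply: cvg_near_cst; exists [fset e]%fset => // A /=.
by rewrite fsub1set => eA; exact: dotp_osum_val.
Qed.

(** The partial sum [p] is the orthogonal projection of [x] onto the span of [A], so Pythagoras
    applies to [p] and [x - p]. *)
Lemma bessel x A : `|osum (fun e => '[x, val e]) A| ^+ 2 <= `|x| ^+ 2.
Proof.
set p := osum _ A.
have xp : '[p, x - p] = 0.
  rewrite linearBr /= dotp_osuml dotp_normE norm_osum.
  apply/eqP; rewrite subr_eq0; apply/eqP/eq_bigr => e _.
  by rewrite (dotpC (val e) x) normCK.
have -> : x = p + (x - p) by rewrite addrC subrK.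
by rewrite pythagoras // lerDl exprn_ge0.
Qed.

End Sums.

(** Bessel bounds the partial sums, so they have a limit [w] with the coefficients of [x]. Then
    [x - w] is orthogonal to the whole basis, hence zero. *)
Lemma parseval B x : orthonormal_basis B ->
  osum (fun e : B => '[x, val e]) @ totally --> x.
Proof.
move=> [B1 B0 Bmax].
have [w cw we] := cvg_osum (conj B1 B0) (bessel (conj B1 B0) x).
suff xw : x = w by rewrite -xw in cw.
apply/eqP; rewrite -subr_eq0; apply/eqP/Bmax => e Be.
rewrite linearBl /=; have := we (SigSub (mem_set Be)) => /= ->.
by rewrite subrr.
Qed.

(** The vector [v] is the sum with coefficients the conjugates of [f e]. Then [f] and the inner
    product with [v] agree on the partial sums of [x], and both are continuous. *)
Lemma riesz (f : H -> R[i]) (M : R[i]) :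
  (forall c x y, f (c *: x + y) = c * f x + f y) ->
  (forall x, `|f x| <= M * `|x|) -> exists v, forall x, f x = '[x, v].
Proof.
move=> flin fM'.
(* [M] is an arbitrary complex number, but [M * |x|] is nonnegative and so equals its modulus. *)
have fM x : `|f x| <= `|M| * `|x|.
  have Mx : 0 <= M * `|x| := le_trans (normr_ge0 _) (fM' x).
  by rewrite -[ `|x|]normr_id -normrM ger0_norm.
have [B onB] := orthonormal_basis_exists.
have [B1 B0 _] := onB; pose Bon := conj B1 B0.
have f0 : f 0 = 0 by have := fM 0; rewrite normr0 mulr0 normr_le0 => /eqP.
have fsum a (A : {fset B}) : f (osum a A) = \sum_(e <- A) a e * f (val e).
  rewrite osumE; elim/big_rec2: _ => [//|e y1 y2 _ <-].
  by rewrite flin.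
pose a (e : B) := (f (val e))^*.
(* With this choice of [a], boundedness of [f] reads [|s|^2 <= |M| |s|] for each partial sum [s],
   which gives [|s| <= |M|]. *)
have fa A : f (osum a A) = `|osum a A| ^+ 2.
  rewrite norm_osum // fsum; apply: eq_bigr => e _.
  by rewrite normCK conjCK mulrC.
have bM A : `|osum a A| ^+ 2 <= `|M| ^+ 2.
  have [->|n0] := eqVneq (osum a A) 0.
    by rewrite normr0 expr0n exprn_ge0.
  have := fM (osum a A); rewrite fa normrX normr_id => nM.
  have n1 : 0 < `|osum a A| by rewrite normr_gt0.
  by rewrite ler_pXn2r ?nnegrE //; move: nM; rewrite expr2 ler_pM2r.
have [v cv va] := cvg_osum Bon bM.
exists v => x; have px := parseval (x := x) onB.
set P := osum _ in px.
apply: (@cvg_complex_unique _ _ totally _ (f \o P)).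
  apply/cvgrPdist_lt => e e0.
  have M1 : 0 < `|M| + 1 by rewrite ltr_wpDl.
  have d0 : 0 < e / (`|M| + 1) by rewrite divr_gt0.
  move/cvgrPdist_lt: px => /(_ _ d0); apply: filterS => A xA.
  have -> : f x - f (P A) = f (x - P A).
    by rewrite addrC -mulN1r -flin scaleN1r addrC.
  apply: le_lt_trans (fM _) _; rewrite mulrC.
  apply: (@le_lt_trans _ _ (`|x - P A| * (`|M| + 1))).
    by rewrite ler_wpM2l // lerDl.
  by rewrite -ltr_pdivlMr.
have -> : f \o P = (fun A => '[P A, v]).
  apply/funext => A; rewrite /= fsum dotp_osuml; apply: eq_bigr => e _.
  by rewrite (dotpC (val e)) va conjCK.
exact: cvg_dotpl px.
Qed.

End OrthonormalSystems.

(** * Rank one operators: products, adjoints, trace and normal form *)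

Section RankOneOperators.
Variables (R : realType) (H : hilbertType R).
Implicit Types (x y z u v w p q : H) (c : R[i]) (A T X : H -> H).

Definition rank_op u v : H -> H := fun x => '[x, v] *: u.

Lemma rank_opM c d u v p q :
  (fun x => c *: rank_op u v x) \o (fun x => d *: rank_op p q x) =
  (fun x => (c * '[p, v] * d) *: rank_op u q x).
Proof.
apply/funext => x; rewrite /rank_op /= !dotpZl !scalerA; congr (_ *: _).
by rewrite -!mulrA; congr (_ * _); rewrite [LHS]mulrA mulrC.
Qed.

Lemma rank_op_comp u v p q :
  rank_op u v \o rank_op p q = (fun x => '[p, v] *: rank_op u q x).
Proof. by apply/funext => x; rewrite /rank_op /= dotpZl !scalerA mulrC. Qed.

(** Any two adjoints differ at each point by a vector orthogonal to all of [H], so the choice made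
    by [xget] is forced. *)
Lemma adjoint_eq T X : is_adjoint T X -> adjoint T = X.
Proof.
move=> TX; rewrite /adjoint; case: xgetP => [S _ TS|/(_ X)//].
apply/funext => y; apply/eqP; rewrite -subr_eq0; apply/eqP/dotp0_eq0 => x.
by rewrite dotpC linearBr /= -TS -TX subrr conjC0.
Qed.

Lemma adjoint_rank_op c u v :
  adjoint (fun x => c *: rank_op u v x) = (fun x => c^* *: rank_op v u x).
Proof.
apply: adjoint_eq => x y; rewrite /rank_op !dotpZl !dotpZr conjCK -dotpC.
by congr (_ * _); rewrite mulrC.
Qed.

Lemma adjoint_rank_op1 u v : adjoint (rank_op u v) = rank_op v u.
Proof. by apply: adjoint_eq => x y; rewrite /rank_op dotpZl dotpZr -dotpC mulrC. Qed.

(** Each partial sum of the trace is the inner product with [v] of a partial Parseval sum of [u]. *)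
Lemma has_trace_rank_op u v : has_trace (rank_op u v) '[u, v].
Proof.
move=> B /(parseval (x := u)) pu.
have -> : partial_sum (fun e : B => '[rank_op u v (val e), val e]) =
          (fun F => '[osum (fun e : B => '[u, val e]) F, v]).
  apply/funext => F; rewrite dotp_osuml partial_sumE.
  by apply: eq_bigr => e _; rewrite /rank_op dotpZl mulrC.
exact: cvg_dotpl pu.
Qed.

Lemma trace_rank_op u v : trace (rank_op u v) = '[u, v].
Proof.
rewrite /trace; case: xgetP => [t _ /= tT|/(_ '[u, v]) []]; last first.
  exact: has_trace_rank_op.
(* [has_trace] quantifies over bases; one actual basis is required to compare the two limits. *)
have [B onB] := orthonormal_basis_exists H.
exact: cvg_complex_unique (tT _ onB) (has_trace_rank_op onB).
Qed.

(** The coordinate of [T x] along [u] is a bounded functional, represented by some [v] through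
    Riesz. As [v] is orthogonal to the kernel, isometry there forces [|v| |u| = 1], and a rescaling
    makes both vectors unit. *)
Lemma rank_one_partial_isometryP T :
  bounded_operator T -> partial_isometry T -> rank_one T ->
  exists u v, [/\ `|u| = 1, `|v| = 1 & T = rank_op u v].
Proof.
move=> [Tlin [M TM]] Tpi [u u0 Tu].
have nu0 : `|u| != 0 by rewrite normr_eq0.
pose f x := '[T x, u] / `|u| ^+ 2.
have Tf x : T x = f x *: u.
  have : range T (T x) by exists x.
  rewrite /f Tu => -[c _ <-].
  by rewrite dotpZl dotp_normE mulfK // expf_neq0.
have [c x y|x|v fv] := @riesz R H f (M / `|u|).
- by rewrite /f Tlin linearDl /= dotpZl mulrDl mulrA.
- by rewrite mulrAC ler_pdivlMr ?normr_gt0 // -normrZ -Tf.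
have Tv x : T x = '[x, v] *: u by rewrite Tf fv.
have v0 : v != 0.
  apply/eqP => v0; have : range T u by rewrite Tu; exists 1 => //; rewrite scale1r.
  by move=> [x _]; rewrite Tv v0 linear0r scale0r => /esym/eqP; rewrite (negPf u0).
have nv0 : `|v| != 0 by rewrite normr_eq0.
have uv1 : `|v| * `|u| = 1.
  have /Tpi : in_ker_orthogonal T v.
    move=> z /eqP; rewrite Tv scaler_eq0 (negPf u0) orbF => /eqP zv.
    by rewrite dotpC zv conjC0.
  rewrite Tv normrZ dotp_normE normrX normr_id expr2 -mulrA.
  by rewrite -[RHS]mulr1 => /(mulfI nv0).
exists (`|u|^-1 *: u), (`|u| *: v); split.
- by rewrite normrZ normfV normr_id mulVf.
- by rewrite normrZ normr_id mulrC.
apply/funext => x; rewrite Tv /rank_op dotpZr scalerA (CrealP _) ?normr_real //.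
by rewrite mulrAC mulfV // mul1r.
Qed.

(** * Words in a rank one partial isometry and its adjoint *)

Section Words.
Variables (u v : H) (u1 : `|u| = 1) (v1 : `|v| = 1).
Local Notation T := (rank_op u v).
Local Notation SG := (semigroup_adj T).
Local Notation t := '[u, v].

Lemma dotp_letter w : w \in [:: u; v] -> '[w, w] = 1.
Proof. by rewrite !inE => /orP[]/eqP->; rewrite dotp_unit. Qed.

Lemma semigroup_rank_op p q :
  p \in [:: u; v] -> q \in [:: u; v] -> SG (rank_op p q).
Proof.
have ST : SG (rank_op u v) by constructor; left.
have SA : SG (rank_op v u) by constructor; right; rewrite /= adjoint_rank_op1.
have c1 w x y : '[x, x] = 1 -> rank_op w x \o rank_op x y = rank_op w y.
  by move=> x1; rewrite rank_op_comp x1; apply/funext => z; rewrite scale1r.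
rewrite !inE => /orP[]/eqP-> /orP[]/eqP-> //.
- by rewrite -(c1 u v u) ?dotp_unit //; exact: (generated_mul ST SA).
- by rewrite -(c1 v u v) ?dotp_unit //; exact: (generated_mul SA ST).
Qed.

(** [K] is left open so that the scalars can be confined to the reals for the SI property and to 0
    and 1 for simplicity. *)
Lemma semigroup_words (K : set R[i]) : K 1 -> K t -> K t^* ->
  (forall c d, K c -> K d -> K (c * d)) ->
  forall A, SG A -> exists c p q,
    [/\ K c, p \in [:: u; v], q \in [:: u; v] &
        A = (fun x => c *: rank_op p q x)].
Proof.
move=> K1 Kt Kt' KM A; elim=> {A} [A|A X _ [c [p [q [Kc pP qP ->]]]] _].
  rewrite /= adjoint_rank_op1 => -[->|->].
    exists 1, u, v; rewrite !inE !eqxx ?orbT; split => //.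
    by apply/funext => x; rewrite scale1r.
  exists 1, v, u; rewrite !inE !eqxx ?orbT; split => //.
  by apply/funext => x; rewrite scale1r.
move=> [d [r [s [Kd rP sP ->]]]].
exists (c * '[r, q] * d), p, s; split => //; last exact: rank_opM.
apply: (KM _ _ _ Kd); apply: (KM _ _ Kc).
(* The inner product created at the junction of two words is 1, [t] or its conjugate. *)
move: qP rP; rewrite !inE => /orP[]/eqP-> /orP[]/eqP->; rewrite ?dotp_unit //.
by rewrite dotpC.
Qed.

Lemma SI_semigroup_rank_op : t \is Num.real -> SI_semigroup SG.
Proof.
move=> tR J [JS JI] _ [A JA <-].
have [||||c [p [q [cR pP qP AE]]]] :=
    @semigroup_words [set c | c \is Num.real] _ _ _ _ A (JS _ JA) => //=.
- by rewrite (CrealP tR).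
- by move=> c d; exact: rpredM.
have Sqp := semigroup_rank_op qP pP.
(* Sandwiching [A] swaps [p] and [q] and keeps the scalar, which equals its own conjugate. *)
suff -> : adjoint A = rank_op q p \o (A \o rank_op q p).
  exact: (JI _ _ (JI _ _ JA Sqp).2 Sqp).1.
rewrite AE adjoint_rank_op (CrealP cR); apply/funext => x.
by rewrite /rank_op /= !dotpZl !dotp_letter // !mulr1 scalerA.
Qed.

Lemma normal_rank_op : `|t| = 1 -> normal_operator T.
Proof.
move=> t1; have tt : t * t^* = 1 by rewrite -normCK t1 expr1n.
(* This is the equality case of Cauchy-Schwarz. *)
have uv : u = t *: v.
  apply/eqP; rewrite -subr_eq0 -(dnorm_eq0 dotp).
  rewrite linearBl /= !linearBr /= !dotpZl !dotpZr !dotp_unit // (dotpC v u).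
  by rewrite !mulr1 mulrC !tt !subrr.
rewrite /normal_operator adjoint_rank_op1 !rank_op_comp; apply/funext => x.
rewrite !dotp_unit // !scale1r /rank_op uv dotpZr scalerA.
by rewrite mulrAC [_^* * t]mulrC tt mul1r.
Qed.

(** If [t] is nonzero, [T^2 = t T] has the kernel of [T], to which [v] is orthogonal. Isometry of
    [T^2] at [v] then gives [|t| = 1], so [T] would be normal. *)
Lemma power_partial_isometry_rank_op :
  power_partial_isometry T -> ~ normal_operator T -> t = 0.
Proof.
move=> /(_ 2 isT) T2 nT; apply/eqP; case: (eqVneq t 0) => // t0.
case: nT; apply: normal_rank_op.
have u0 : u != 0 by rewrite -normr_eq0 u1 oner_eq0.
have := T2 v; rewrite /= /rank_op !dotpZl !dotp_unit // mul1r.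
rewrite normrZ u1 v1 mulr1; apply => z; rewrite /= dotpZl => /eqP.
rewrite scaler_eq0 (negPf u0) orbF mulf_eq0 (negPf t0) orbF => /eqP zv.
by rewrite dotpC zv conjC0.
Qed.

Lemma simple_semigroup_rank_op : t = 0 -> simple_semigroup SG.
Proof.
move=> t0 J [JS JI] [A JA A0].
have [|||c d|c [p [q [c01 pP qP AE]]]] :=
    @semigroup_words [set 0; 1] _ _ _ _ A (JS _ JA).
- by right.
- by left.
- by left; rewrite t0 conjC0.
- by move=> [->|->] [->|->]; rewrite ?mul0r ?mul1r; [left|left|left|right].
have c1 : c = 1.
  by case: c01 => // c0; case: A0; rewrite AE c0; apply/funext => x; rewrite scale0r.
have JE r s : r \in [:: u; v] -> s \in [:: u; v] -> J (rank_op r s).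
  (* Multiplying on both sides replaces [p] and [q] by arbitrary letters, so one nonzero element of
     [J] yields all four rank one words. *)
  move=> rP sP; have -> : rank_op r s = rank_op r p \o (A \o rank_op q s).
    apply/funext => x.
    by rewrite AE c1 /rank_op /= scale1r !dotpZl !dotp_letter // !mulr1.
  apply: (JI _ _ (JI _ _ JA _).2 _).1; exact: semigroup_rank_op.
apply/seteqP; split=> // X; elim=> {X} [X|X Y _ JX SY _].
  rewrite /= adjoint_rank_op1 => -[->|->]; apply: JE; rewrite !inE eqxx ?orbT //.
exact: (JI _ _ JX SY).2.
Qed.

Lemma rank_op_contraction p q x : `|p| = 1 -> `|q| = 1 -> `|rank_op p q x| <= `|x|.
Proof.
move=> p1 q1; rewrite normrZ p1 mulr1.
by apply: le_trans (CauchySchwarz_dotp _ _) _; rewrite q1 mulr1.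
Qed.

Lemma bounded_rank_op : bounded_operator T.
Proof.
split=> [c x y|]; first by rewrite /rank_op linearDl /= dotpZl scalerDl scalerA.
by exists 1 => x; rewrite mul1r rank_op_contraction.
Qed.

(** The vector [x - <x, v> v] lies in the kernel, so an [x] orthogonal to the kernel is a multiple
    of [v]. *)
Lemma partial_isometry_rank_op : partial_isometry T.
Proof.
move=> x xT; have oxv : '[x, x - '[x, v] *: v] = 0.
  by apply: xT; rewrite /rank_op linearBl /= dotpZl dotp_unit // mulr1 subrr scale0r.
have -> : x = '[x, v] *: v.
  apply/eqP; rewrite -subr_eq0 -(dnorm_eq0 dotp) linearBl /= oxv dotpZl.
  rewrite linearBr /= dotpZr dotp_unit // mulr1 (dotpC v x).
  by rewrite subrr mulr0 subrr.
by rewrite /rank_op dotpZl dotp_unit // mulr1 !normrZ u1 v1.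
Qed.

Lemma rank_one_rank_op : rank_one T.
Proof.
exists u; first by rewrite -normr_eq0 u1 oner_eq0.
apply/seteqP; split=> [_ [x _ <-]|_ [c _ <-]]; first by exists '[x, v].
by exists (c *: v) => //; rewrite /rank_op dotpZl dotp_unit // mulr1.
Qed.

Lemma not_normal_rank_op : `|t| < 1 -> ~ normal_operator T.
Proof.
move=> t1; rewrite /normal_operator adjoint_rank_op1 !rank_op_comp.
(* At [v] the two products have norms 1 and [|t|]. *)
move=> /(congr1 (fun f => `|f v|)); rewrite !dotp_unit // !scale1r /rank_op.
rewrite !normrZ u1 v1 dotp_unit // normr1 !mulr1 dotpC norm_conjC => tE.
by rewrite -tE ltxx in t1.
Qed.

Lemma not_simple_semigroup_rank_op : t != 0 -> `|t| < 1 -> ~ simple_semigroup SG.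
Proof.
move=> t0 t1; have SGc A : SG A -> forall x, `|A x| <= `|x|.
  elim=> {A} [A|A X _ hA _ hX x]; last exact: le_trans (hA _) (hX _).
  by rewrite /= adjoint_rank_op1 => -[->|->] x; exact: rank_op_contraction.
have ST : SG T by constructor; left.
(* The elements of norm at most [|t|]: [T] has norm 1, and [T^2 = t T]. *)
pose J := SG `&` [set A | forall x, `|A x| <= `|t| * `|x|].
have TT x : (T \o T) x = t *: T x by rewrite rank_op_comp.
move=> /(_ J) JSG; have JE : J = SG.
  apply: JSG.
    (* All words are contractions, so a further factor preserves the bound [|t|]. *)
    split=> [A []//|A X [SA tA] SX]; split; split; try exact: generated_mul.
      by move=> x; exact: le_trans (SGc _ SX _) (tA _).
    by move=> x; apply: le_trans (tA _) _; rewrite ler_wpM2l // SGc.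
  exists (T \o T).
    split; first exact: generated_mul.
    by move=> x; rewrite TT normrZ ler_wpM2l // rank_op_contraction.
  move=> /(congr1 (fun f => f v)); rewrite TT /rank_op dotp_unit // scale1r.
  by apply/eqP; rewrite scaler_eq0 (negPf t0) -normr_eq0 u1 oner_eq0.
have : J T by rewrite JE.
case=> _ /(_ v); rewrite /rank_op dotp_unit // scale1r u1 v1 mulr1.
by move=> /(lt_le_trans t1); rewrite ltxx.
Qed.

End Words.
End RankOneOperators.

(** * Finite-dimensional Hermitian space as a Hilbert space *)

Section HermitianSpace.
Variables (R : realType) (n : nat).

(* An alias, since ['rV_n] carries the supremum norm. *)
Definition hermitian_space := 'rV[R[i]]_n.

HB.instance Definition _ := GRing.Lmodule.on hermitian_space.
HB.instance Definition _ := Vector.on hermitian_space.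

Implicit Types (x y : hermitian_space).

Definition hermitian_norm x : R[i] := sqrtC (dotmx x x).

Lemma hermitian_normD x y : hermitian_norm (x + y) <= hermitian_norm x + hermitian_norm y.
Proof. exact: (triangle_lerif (@dotmx R[i] n) x y).1. Qed.

Lemma hermitian_normZ (c : R[i]) x : hermitian_norm (c *: x) = `|c| * hermitian_norm x.
Proof.
rewrite /hermitian_norm (dnormZ (@dotmx R[i] n)) sqrtCM ?nnegrE ?exprn_ge0 //.
by rewrite sqrCK.
Qed.

Lemma hermitian_norm_eq0 x : hermitian_norm x = 0 -> x = 0.
Proof.
by move/eqP; rewrite sqrtC_eq0 (dnorm_eq0 (@dotmx R[i] n)) => /eqP.
Qed.

HB.instance Definition _ :=
  Lmodule_isNormed.Build R[i] hermitian_space hermitian_normD hermitian_normZ hermitian_norm_eq0.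

Lemma hermitian_normE x : `|x| ^+ 2 = \sum_i `|x 0 i| ^+ 2.
Proof.
rewrite [ `|x|]/(hermitian_norm x) /hermitian_norm sqrtCK dotmxE mxE.
by apply: eq_bigr => i _; rewrite !mxE normCK.
Qed.

Lemma hermitian_coord_le x i : `|x 0 i| <= `|x|.
Proof.
rewrite -(@ler_pXn2r _ 2) ?nnegrE // hermitian_normE (bigD1 i) //= lerDl.
by apply: sumr_ge0 => j _; exact: exprn_ge0.
Qed.

Lemma hermitian_norm_le x : `|x| <= \sum_i `|x 0 i|.
Proof.
rewrite -(@ler_pXn2r _ 2) ?nnegrE ?sumr_ge0 // hermitian_normE.
rewrite expr2 mulr_sumr; apply: ler_sum => i _.
rewrite expr2 ler_wpM2r // (bigD1 i) //= lerDl.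
by apply: sumr_ge0.
Qed.

(** Completeness is reduced to that of [R] through these [2n] coordinates. *)
Definition real_coord (k : 'I_n * bool) x : R :=
  if k.2 then complex.Re (x 0 k.1) else complex.Im (x 0 k.1).

Lemma complex_Im_le (c : R[i]) : `|complex.Im c|%:C <= `|c|.
Proof.
by rewrite normc_def lecR -sqrtr_sqr ler_wsqrtr // lerDr sqr_ge0.
Qed.

Lemma complex_norm_le (c : R[i]) :
  `|c| <= (`|complex.Re c| + `|complex.Im c|)%:C.
Proof.
rewrite normc_def lecR -[leRHS]ger0_norm ?addr_ge0 // -sqrtr_sqr.
rewrite ler_wsqrtr // sqrrD !real_normK ?num_real //.
by rewrite addrAC lerDl mulrn_wge0 // mulr_ge0.
Qed.

Lemma real_coord_le k x y : `|real_coord k x - real_coord k y|%:C <= `|x - y|.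
Proof.
apply: le_trans (hermitian_coord_le (x - y) k.1); rewrite /real_coord !mxE.
case: k => i [] /=.
  by apply: le_trans (normc_ge_Re _); rewrite raddfB.
by apply: le_trans (complex_Im_le _); rewrite raddfB.
Qed.

(** Real coordinates are 1-Lipschitz, so they send a Cauchy filter to Cauchy filters in [R]; the
    vector of their limits is the limit. *)
Lemma hermitian_complete (F : set_system hermitian_space) :
  ProperFilter F -> cauchy F -> cvg F.
Proof.
move=> FF /cauchyP Fc.
have cvg_coord k : cvg (real_coord k @ F).
  apply: cauchy_cvg; apply: cauchy_exP => r r0.
  have [|x Fx] := Fc r%:C; first by rewrite ltcR.
  exists (real_coord k x); rewrite -!ball_normE in Fx *.
  change (F (real_coord k @^-1` (ball_ Num.norm (real_coord k x) r))).
  apply: filterS Fx => y /= xy.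
  by rewrite -ltcR; exact: le_lt_trans (real_coord_le _ _ _) xy.
pose l k : R := lim (real_coord k @ F).
pose L : hermitian_space := \row_i (l (i, true) +i* l (i, false)).
apply/cvg_ex; exists L; apply/fcvgrPdist_lt => e e0.
have eE : e = (complex.Re e)%:C by rewrite RRe_real ?gtr0_real.
have r0 : 0 < complex.Re e by rewrite -ltcR -eE.
set r := complex.Re e in eE r0.
(* The [2n] coordinate errors add up to at most [2n d]; the extra 1 makes this strictly less than
   [r] and covers [n = 0]. *)
pose d := r / (n.*2.+1)%:R.
have d0 : 0 < d by rewrite divr_gt0.
have : \forall x \near F, forall k, `|l k - real_coord k x| < d.
  apply: filter_forall => k.
  by have /cvgrPdist_lt/(_ _ d0) := cvg_coord k.
apply: filterS => x xd.
apply: le_lt_trans (hermitian_norm_le _) _.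
apply: (@le_lt_trans _ _ (\sum_(i < n) (d + d)%:C)).
  apply: ler_sum => i _; apply: le_trans (complex_norm_le _) _.
  rewrite lecR !mxE !raddfB /= lerD //.
    exact: ltW (xd (i, true)).
  exact: ltW (xd (i, false)).
rewrite sumr_const card_ord -rmorphMn eE ltcR -mulr2n -mulrnA mul2n.
rewrite /d -[_ *+ n.*2]mulr_natr -mulrA gtr_pMr // mulrC ltr_pdivrMr ?ltr0n //.
by rewrite mul1r ltr_nat.
Qed.

HB.instance Definition _ := Uniform_isComplete.Build hermitian_space hermitian_complete.

Definition hermitian_dot : {dot hermitian_space for (@Num.conj R[i])} := @dotmx R[i] n.

Lemma hermitian_dotE x : hermitian_dot x x = `|x| ^+ 2.
Proof. by rewrite [ `|x|]/(hermitian_norm x) sqrtCK. Qed.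

HB.instance Definition _ := NormedModule_isHilbert.Build R hermitian_space hermitian_dotE.

End HermitianSpace.

Lemma hermitian_dotpE (R : realType) (n : nat) (x y : hermitian_space R n) :
  '[x, y] = \sum_i x 0 i * (y 0 i)^*.
Proof.
transitivity (dotmx x y); first by [].
rewrite dotmxE mxE.
by apply: eq_bigr => i _; rewrite !mxE.
Qed.

Lemma unit_vectors_exist (R : realType) :
  exists (H : hilbertType R) (u v : H),
    [/\ `|u| = 1, `|v| = 1 & '[u, v] = 3 / 5].
Proof.
pose H : hilbertType R := hermitian_space R 2.
(* The triple 3, 4, 5 gives a unit vector [v] with rational entries. *)
pose u : H := \row_i (if i == 0 then 1 else 0).
pose v : H := \row_i (if i == 0 then 3 / 5 else 4 / 5).
have unit (x : H) : '[x, x] = 1 -> `|x| = 1.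
  rewrite dotp_normE => /eqP; rewrite sqrp_eq1 //; exact/eqP.
have c35 : (3 / 5 : R[i])^* = 3 / 5.
  by apply/CrealP; rewrite rpred_div ?rpred_nat.
have c45 : (4 / 5 : R[i])^* = 4 / 5.
  by apply/CrealP; rewrite rpred_div ?rpred_nat.
exists H, u, v; split.
- apply: unit; rewrite hermitian_dotpE !big_ord_recl big_ord0 !mxE /=.
  by rewrite conjC1 mulr1 !mul0r !addr0.
- apply: unit; rewrite hermitian_dotpE !big_ord_recl big_ord0 !mxE /= c35 c45.
  by field.
- rewrite hermitian_dotpE !big_ord_recl big_ord0 !mxE /= c35.
  by rewrite !mul0r !addr0 mul1r.
Qed.

Theorem corollary3p18 (R : realType) :
  (forall (H : hilbertType R) (T : H -> H),
     bounded_operator T -> partial_isometry T -> rank_one T ->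
     ~ normal_operator T ->
     (power_partial_isometry T -> simple_semigroup (semigroup_adj T)) /\
     (trace T \is Num.real -> SI_semigroup (semigroup_adj T))) /\
  (exists (H : hilbertType R) (T : H -> H),
     [/\ bounded_operator T, partial_isometry T, rank_one T &
         ~ normal_operator T] /\
     [/\ trace T \is Num.real & ~ simple_semigroup (semigroup_adj T)]).
Proof.
split=> [H T Tb Tpi T1 Tn|].
  have [u [v [u1 v1 TE]]] := rank_one_partial_isometryP Tb Tpi T1.
  rewrite TE in Tn *; split.
    by move=> Tp; apply: simple_semigroup_rank_op => //;
       exact: power_partial_isometry_rank_op.
  by rewrite trace_rank_op; exact: SI_semigroup_rank_op.
have [H [u [v [u1 v1 tE]]]] := unit_vectors_exist R.
(* A nonzero [t] keeps [T^2] nonzero in the ideal; [|t| < 1] gives non-normality and leaves [T]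
   outside it. *)
have t0 : '[u, v] != 0 by rewrite tE mulf_neq0 ?invr_eq0 ?pnatr_eq0.
have t1 : `|'[u, v]| < 1.
  by rewrite tE ger0_norm ?divr_ge0 // ltr_pdivrMr ?ltr0n // mul1r ltr_nat.
exists H, (rank_op u v); split.
  split; [exact: bounded_rank_op|exact: partial_isometry_rank_op
         |exact: rank_one_rank_op|exact: not_normal_rank_op].
split; last exact: not_simple_semigroup_rank_op.
by rewrite trace_rank_op tE rpred_div ?rpred_nat.
Qed.
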